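(* Let $R$ be a Noetherian unique factorization domain of prime characteristic $p>0$. Then the perfection $R_{\mathrm{perf}}$ is a GCD domain.
   Context: For a ring $R$ of prime characteristic $p>0$, the perfection (perfect closure) of $R$ is $R_{\mathrm{perf}}=\varinjlim\left(R\xrightarrow{F}R\xrightarrow{F}\cdots\right)$, where $F:R\to R$ is the Frobenius map $r\mapsto r^p$. A domain $A$ (not necessarily Noetherian) is a GCD domain if for all $r,s\in A$ the ideal $rA\cap sA$ is principal (equivalently, the ideal $(r:_A s)=\{x\in A\mid xs\in rA\}$ is principal for all $r,s \in A$ with $s\neq 0$). *)

(* Defs.v *)
From HB Require Import structures.
From mathcomp Require Import all_boot all_algebra.
From mathcomp Require Import zify.
From mathcomp Require Import boolp classical_sets.

Set Implicit Arguments.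
Unset Strict Implicit.
Unset Printing Implicit Defensive.

Import GRing.Theory.
Local Open Scope ring_scope.
Local Open Scope quotient_scope.
Local Open Scope classical_set_scope.

Section Ideals.
Variable R : comNzRingType.

Definition is_ideal (I : set R) : Prop :=
  [/\ I 0, (forall x y, I x -> I y -> I (x + y)) & (forall a x, I x -> I (a * x))].

Definition ideal_gen n (g : 'I_n -> R) : set R :=
  [set x | exists c : 'I_n -> R, x = \sum_(i < n) c i * g i].

Definition principal_ideal (r : R) : set R := [set x | exists a, x = a * r].

Definition noetherian : Prop :=
  forall I : set R, is_ideal I ->
    exists (n : nat) (g : 'I_n -> R), I = ideal_gen g.

Definition gcd_domain : Prop :=
  (forall x y : R, x * y = 0 -> x = 0 \/ y = 0) /\
  (forall r s : R, exists d : R,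
     principal_ideal r `&` principal_ideal s = principal_ideal d).

End Ideals.

Section UniqueFactorization.
Variable R : idomainType.

Definition irreducible (q : R) : Prop :=
  [/\ q != 0, q \isn't a GRing.unit &
      forall a b, q = a * b -> a \is a GRing.unit \/ b \is a GRing.unit].

Definition associated (x y : R) : Prop :=
  exists2 u, u \is a GRing.unit & y = u * x.

Definition factorization (x : R) (s : seq R) : Prop :=
  (forall q, q \in s -> irreducible q) /\ x = \prod_(q <- s) q.

Definition same_factors (s t : seq R) : Prop :=
  exists t' : seq R,
    [/\ perm_eq t t', size s = size t' &
        forall i, (i < size s)%N -> associated s`_i t'`_i].

Definition unique_factorization_domain : Prop :=
  forall x : R, x != 0 -> x \isn't a GRing.unit ->
    (exists s, factorization x s) /\
    (forall s t, factorization x s -> factorization x t -> same_factors s t).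

End UniqueFactorization.

Module Perfection.
Section Perfection.
Variables (R : comNzRingType) (p : nat) (chRp : p \in [pchar R]).

Local Notation F n := (iter n (pFrobenius_aut chRp)).

Lemma iterF_D n : {morph F n : x y / x + y}.
Proof. by elim: n => // n IH x y /=; rewrite IH rmorphD. Qed.

Lemma iterF_M n : {morph F n : x y / x * y}.
Proof. by elim: n => // n IH x y /=; rewrite IH rmorphM. Qed.

Lemma iterF_N n : {morph F n : x / - x}.
Proof. by elim: n => // n IH x /=; rewrite IH rmorphN. Qed.

Lemma iterF_0 n : F n 0 = 0.
Proof. by elim: n => // n IH /=; rewrite IH rmorph0. Qed.

Lemma iterF_1 n : F n 1 = 1.
Proof. by elim: n => // n IH /=; rewrite IH rmorph1. Qed.

Lemma iterFE n x : F n x = x ^+ (p ^ n)%N.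
Proof.
by elim: n => [|n IH] /=; rewrite ?expr1 // IH pFrobenius_autE -exprM expnSr.
Qed.

(* The colimit is a quotient of the disjoint union of countably many copies of
   R: (n, a) is the element a of the n-th copy, and two elements are identified
   when they become equal in some later copy. *)
Local Notation dom := (nat * R)%type.

Definition colim_rel (u v : dom) : Prop :=
  exists k, [/\ (u.1 <= k)%N, (v.1 <= k)%N & F (k - u.1) u.2 = F (k - v.1) v.2].

Definition equivp (u v : dom) : bool := `[< colim_rel u v >].

Lemma equivp_refl : reflexive equivp.
Proof. by move=> u; apply/asboolP; exists u.1. Qed.

Lemma equivp_sym : symmetric equivp.
Proof.
by move=> u v; apply/asboolP/asboolP => -[k [uk vk e]]; exists k; split.
Qed.

Lemma iterF_sub k l n x :
  (n <= k)%N -> (k <= l)%N -> F (l - n) x = F (l - k) (F (k - n) x).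
Proof. by move=> nk kl; rewrite -iterD addnBA // subnK. Qed.

Lemma equivp_trans : transitive equivp.
Proof.
move=> v u w /asboolP[k [uk vk e]] /asboolP[l [vl wl e']]; apply/asboolP.
have kkl := leq_addr l k; have lkl := leq_addl k l.
exists (k + l)%N; split; [exact: leq_trans kkl|exact: leq_trans lkl|].
by rewrite (iterF_sub _ uk kkl) e -iterF_sub // (iterF_sub _ vl lkl) e' -iterF_sub.
Qed.

Canonical equivp_equiv := EquivRel equivp equivp_refl equivp_sym equivp_trans.

Definition type := {eq_quot equivp}.
HB.instance Definition _ : EqQuotient _ equivp type := EqQuotient.on type.
HB.instance Definition _ := Choice.on type.

Definition inj (n : nat) (a : R) : type := \pi_type (n, a).

Lemma injP n a m b : inj n a = inj m b <-> colim_rel (n, a) (m, b).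
Proof.
split=> [/eqmodP/asboolP //|h]; by apply/eqmodP/asboolP.
Qed.

Lemma injW (P : type -> Prop) : (forall n a, P (inj n a)) -> forall x, P x.
Proof. by move=> h; elim/quotW => -[n a]; apply: h. Qed.

Lemma inj_iterF k n a : inj (n + k) (F k a) = inj n a.
Proof.
apply/injP; exists (n + k)%N; rewrite /= leqnn leq_addr; split => //.
by rewrite subnn addKn.
Qed.

Lemma inj_common (x y : type) : exists n a b, x = inj n a /\ y = inj n b.
Proof.
elim/injW: x => n a; elim/injW: y => m b.
exists (n + m)%N, (F m a), (F n b); rewrite inj_iterF; split=> //.
by rewrite addnC inj_iterF.
Qed.

Definition addd (u v : dom) : dom := ((u.1 + v.1)%N, F v.1 u.2 + F u.1 v.2).
Definition muld (u v : dom) : dom := ((u.1 + v.1)%N, F v.1 u.2 * F u.1 v.2).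
Definition oppd (u : dom) : dom := (u.1, - u.2).

Definition add (x y : type) : type := \pi_type (addd (repr x) (repr y)).
Definition mul (x y : type) : type := \pi_type (muld (repr x) (repr y)).
Definition opp (x : type) : type := \pi_type (oppd (repr x)).
Definition zero : type := inj 0 0.
Definition one : type := inj 0 1.

Lemma repr_inj n a : exists m b, repr (inj n a) = (m, b) /\
  exists k, [/\ (m <= k)%N, (n <= k)%N & F (k - m) b = F (k - n) a].
Proof.
case e: (repr (inj n a)) => [m b]; exists m, b; split=> //.
have /injP[k [/= h1 h2 h3]] : inj m b = inj n a by rewrite -[RHS]reprK e.
by exists k.
Qed.

Lemma op_common (op : R -> R -> R) (opF : forall k, {morph F k : x y / op x y})
    n a b m1 b1 m2 b2 :
  colim_rel (m1, b1) (n, a) -> colim_rel (m2, b2) (n, b) ->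
  inj (m1 + m2) (op (F m2 b1) (F m1 b2)) = inj n (op a b).
Proof.
move=> [k [/= mk nk e]] [l [/= ml nl e']]; apply/injP.
exists (k + l)%N; rewrite /= leq_add // (leq_trans nk) ?leq_addr //; split=> //.
have kkl := leq_addr l k; have lkl := leq_addl k l.
rewrite !opF -!iterD; congr op.
- rewrite (iterF_sub _ nk kkl) -e -iterF_sub //; congr iter; lia.
- rewrite (iterF_sub _ nl lkl) -e' -iterF_sub //; congr iter; lia.
Qed.

Lemma addE n a b : add (inj n a) (inj n b) = inj n (a + b).
Proof.
rewrite /add; have [m1 [b1 [-> h1]]] := repr_inj n a.
have [m2 [b2 [-> h2]]] := repr_inj n b.
exact: (op_common iterF_D).
Qed.

Lemma mulE n a b : mul (inj n a) (inj n b) = inj n (a * b).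
Proof.
rewrite /mul; have [m1 [b1 [-> h1]]] := repr_inj n a.
have [m2 [b2 [-> h2]]] := repr_inj n b.
exact: (op_common iterF_M).
Qed.

Lemma oppE n a : opp (inj n a) = inj n (- a).
Proof.
rewrite /opp; have [m [b [-> [k [mk nk e]]]]] := repr_inj n a.
by apply/injP; exists k; split=> //=; rewrite !iterF_N e.
Qed.

Lemma zeroE n : zero = inj n 0.
Proof. by rewrite /zero -(inj_iterF n 0 0) iterF_0 add0n. Qed.

Lemma oneE n : one = inj n 1.
Proof. by rewrite /one -(inj_iterF n 0 1) iterF_1 add0n. Qed.

Lemma inj_common3 (x y z : type) :
  exists n a b c, [/\ x = inj n a, y = inj n b & z = inj n c].
Proof.
have [n [a [b [-> ->]]]] := inj_common x y; elim/injW: z => m c.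
exists (n + m)%N, (F m a), (F m b), (F n c); rewrite !inj_iterF; split=> //.
by rewrite addnC inj_iterF.
Qed.

Lemma addA : associative add.
Proof.
by move=> x y z; have [n [a [b [c [-> -> ->]]]]] := inj_common3 x y z;
  rewrite !addE addrA.
Qed.

Lemma addC : commutative add.
Proof.
by move=> x y; have [n [a [b [-> ->]]]] := inj_common x y; rewrite !addE addrC.
Qed.

Lemma add0 : left_id zero add.
Proof. by elim/injW => n a; rewrite (zeroE n) addE add0r. Qed.

Lemma addN : left_inverse zero opp add.
Proof. by elim/injW => n a; rewrite (zeroE n) oppE addE addNr. Qed.

Lemma mulA : associative mul.
Proof.
by move=> x y z; have [n [a [b [c [-> -> ->]]]]] := inj_common3 x y z;
  rewrite !mulE mulrA.
Qed.

Lemma mulC : commutative mul.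
Proof.
by move=> x y; have [n [a [b [-> ->]]]] := inj_common x y; rewrite !mulE mulrC.
Qed.

Lemma mul1 : left_id one mul.
Proof. by elim/injW => n a; rewrite (oneE n) mulE mul1r. Qed.

Lemma mulDl : left_distributive mul add.
Proof.
by move=> x y z; have [n [a [b [c [-> -> ->]]]]] := inj_common3 x y z;
  rewrite !(mulE, addE) mulrDl.
Qed.

Lemma one_neq0 : one != zero.
Proof.
apply/eqP => /injP[k [_ _ /=]]; rewrite iterF_0 iterF_1 => /eqP.
by rewrite oner_eq0.
Qed.

HB.instance Definition _ := GRing.isZmodule.Build type addA addC add0 addN.
HB.instance Definition _ :=
  GRing.Zmodule_isComNzRing.Build type mulA mulC mul1 mulDl one_neq0.

End Perfection.
End Perfection.
HB.export Perfection.

Definition perfection (R : comNzRingType) (p : nat) (chRp : p \in [pchar R]) :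
  comNzRingType := Perfection.type chRp.

Section UniversalProperty.
Variables (R : comNzRingType) (p : nat) (chRp : p \in [pchar R]).

Definition perf_in (n : nat) (a : R) : perfection chRp := Perfection.inj chRp n a.

Lemma perf_in_is_zmod_morphism n : zmod_morphism (perf_in n).
Proof.
move=> a b; rewrite /perf_in -Perfection.addE -Perfection.oppE; reflexivity.
Qed.

Lemma perf_in_is_monoid_morphism n : monoid_morphism (perf_in n).
Proof.
split; first by rewrite /perf_in -Perfection.oneE.
by move=> a b; rewrite /perf_in -Perfection.mulE.
Qed.

HB.instance Definition _ n :=
  GRing.isZmodMorphism.Build R (perfection chRp) (perf_in n)
    (perf_in_is_zmod_morphism n).
HB.instance Definition _ n :=
  GRing.isMonoidMorphism.Build R (perfection chRp) (perf_in n)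
    (perf_in_is_monoid_morphism n).

Lemma perf_in_Frobenius n a : perf_in n.+1 (pFrobenius_aut chRp a) = perf_in n a.
Proof. by rewrite -addn1; exact: (Perfection.inj_iterF chRp 1). Qed.

Lemma perf_in_eq n a m b :
  perf_in n a = perf_in m b <->
  exists k, [/\ (n <= k)%N, (m <= k)%N &
    iter (k - n) (pFrobenius_aut chRp) a = iter (k - m) (pFrobenius_aut chRp) b].
Proof. exact: Perfection.injP. Qed.

Lemma perf_in_surj (x : perfection chRp) : exists n a, x = perf_in n a.
Proof. by elim/Perfection.injW: x => n a; exists n, a. Qed.

Lemma perfection_universal (S : comNzRingType) (f : nat -> {rmorphism R -> S}) :
  (forall n a, f n.+1 (pFrobenius_aut chRp a) = f n a) ->
  exists! g : perfection chRp -> S,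
    [/\ zmod_morphism g, monoid_morphism g & forall n a, g (perf_in n a) = f n a].
Proof.
move=> fF; pose g (x : perfection chRp) : S := f (repr x).1 (repr x).2.
have fiter k n a : f (n + k)%N (iter k (pFrobenius_aut chRp) a) = f n a.
  by elim: k => [|k IH]; rewrite ?addn0 //= addnS fF.
have gE n a : g (perf_in n a) = f n a.
  rewrite /g; have [m [b [-> [k [mk nk e]]]]] := Perfection.repr_inj chRp n a.
  by rewrite /= -(fiter (k - m)%N) subnKC // e -[k in f k](subnKC nk) fiter.
exists g; split; last first.
  move=> h [_ _ hE]; apply: funext => x.
  by have [n [a ->]] := perf_in_surj x; rewrite gE hE.
split=> //; [move=> x y|split=> [|x y]].
- have [n [a [b [-> ->]]]] := Perfection.inj_common x y.
  by rewrite -!/(perf_in n _) -rmorphB !gE rmorphB.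
- by rewrite -(rmorph1 (perf_in 0)) gE rmorph1.
- have [n [a [b [-> ->]]]] := Perfection.inj_common x y.
  by rewrite -!/(perf_in n _) -rmorphM !gE rmorphM.
Qed.

End UniversalProperty.

(* Main.v *)
Require Import Defs.
From mathcomp Require Import all_boot all_algebra.
From mathcomp Require Import ring boolp.

(** The perfection is the increasing union of the rings of p^n-th roots of
    elements of R, each of them a copy of R.  Divisibility in the union can be
    tested in R after raising to powers: for a and c in the same copy of R,
    a divides c in the perfection iff a^(p^k) divides c^(p^k) in R for some k
    (perf_dvdP).  So a least common multiple l of a and b in R stays one in the
    perfection as soon as l^n is a least common multiple of a^n and b^n for all
    powers n of p.

    This holds for every n (ufd_lcm_exp), without comparing factorizations of
    powers.  Write a = g * a' and b = g * b' with a' and b' coprime, in the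
    sense that b' divides y whenever it divides a' * y.  This form of
    coprimality passes to powers by two short inductions (coprime_expl,
    coprime_expr), and makes g^n * a'^n * b'^n a least common multiple of a^n
    and b^n.  Unique factorization serves only to extract g
    (coprime_cofactors): irreducible elements are prime, and the prime factors
    of a are moved one by one into g or into a'. *)

Set Implicit Arguments.
Unset Strict Implicit.
Unset Printing Implicit Defensive.

Import GRing.Theory.
Local Open Scope ring_scope.

Local Notation dvd := principal_ideal.

Section Divisibility.
Variable R : comNzRingType.
Implicit Types a b c d x y : R.

Lemma dvd_refl x : dvd x x.
Proof. by exists 1; rewrite mul1r. Qed.

Lemma dvd_mull c d x : dvd d x -> dvd d (c * x).
Proof. by case=> z ->; exists (c * z); rewrite mulrA. Qed.

Lemma dvd_trans d x y : dvd d x -> dvd x y -> dvd d y.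
Proof. by move=> dx [z ->]; apply: dvd_mull. Qed.

Lemma dvd_exp n d x : dvd d x -> dvd (d ^+ n) (x ^+ n).
Proof. by case=> z ->; exists (z ^+ n); rewrite exprMn. Qed.

(** Coprimality in cancellation form: it is weaker than comaximality of a and
    b, but strong enough to make a * b a least common multiple of them. *)
Definition coprime_elt a b : Prop := forall y, dvd b (a * y) -> dvd b y.

Lemma coprime_expl n a b : coprime_elt a b -> coprime_elt (a ^+ n) b.
Proof.
move=> cab; elim: n => [|n IH] y; first by rewrite mul1r.
by rewrite exprS -mulrA => /cab/IH.
Qed.

End Divisibility.

Section UniqueFactorization.
Variable R : idomainType.
Implicit Types a b c x y q : R.

Lemma dvd_mul2l c x y : c != 0 -> dvd (c * x) (c * y) -> dvd x y.
Proof. by move=> c0 [z e]; exists z; apply: (mulfI c0); rewrite e mulrCA. Qed.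

(** An induction on n: cancelling one factor b first gives y = b * z, and the
    remaining n factors then have to divide a * z. *)
Lemma coprime_expr n a b : b != 0 -> coprime_elt a b -> coprime_elt a (b ^+ n).
Proof.
move=> b0 cab; elim: n => [|n IH] y; first by exists y; rewrite mulr1.
rewrite exprS => bay.
have [z ez] : dvd b y.
  by apply/cab/(dvd_trans _ bay); exists (b ^+ n); rewrite mulrC.
rewrite ez mulrC.
have /IH[w ->] : dvd (b ^+ n) (a * z).
  by apply: (dvd_mul2l b0); rewrite mulrCA [b * z]mulrC -ez.
by exists w; ring.
Qed.

Hypothesis ufdR : unique_factorization_domain R.

(** Write x = q * z, complete q by the factors of z to a factorization of x,
    and compare it with s: by uniqueness some entry of s is associated to q. *)
Lemma irreducible_dvd_factor q x s :
  irreducible q -> x != 0 -> x \isn't a GRing.unit -> factorization x s ->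
  dvd q x -> exists2 r, r \in s & dvd q r.
Proof.
move=> irq x0 xnu fs [z exz].
(* The cofactor z may be a unit, which has no factorization into irreducibles:
   then x itself is irreducible, and takes the place of q in the comparison. *)
have [q' [t [qq' ft]]] : exists q' t, dvd q q' /\ factorization x (q' :: t).
  have z0 : z != 0 by apply: contraNneq x0 => z0; rewrite exz z0 mul0r.
  have [zu|znu] := boolP (z \is a GRing.unit).
    exists x, [::]; split; first by exists z.
    split=> [r|]; last by rewrite big_seq1.
    rewrite inE => /eqP ->; split=> // a b eab.
    case: irq => _ _ /(_ (z^-1 * a) b).
    rewrite -mulrA -eab exz mulKr // unitrM unitrV zu; exact.
  have [[t [irt et]] _] := ufdR z0 znu.
  exists q, t; split; first exact: dvd_refl.
  split=> [r|]; last by rewrite big_cons -et mulrC.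
  by rewrite inE => /predU1P[->|/irt].
have [_ /(_ _ _ ft fs) [s' [pss' sz /(_ 0)[] // u uu e]]] := ufdR x0 xnu.
exists s'`_0; first by rewrite (perm_mem pss') mem_nth // -sz.
by rewrite e; apply: dvd_mull.
Qed.

Lemma irreducible_prime q x y :
  irreducible q -> dvd q (x * y) -> dvd q x \/ dvd q y.
Proof.
move=> irq qxy.
have [->|x0] := eqVneq x 0; first by left; exists 0; rewrite mul0r.
have [->|y0] := eqVneq y 0; first by right; exists 0; rewrite mul0r.
have [xu|xnu] := boolP (x \is a GRing.unit).
  by right; rewrite -(mulKr xu y); apply: dvd_mull.
have [yu|ynu] := boolP (y \is a GRing.unit).
  by left; rewrite -(mulrK yu x) mulrC; apply: dvd_mull.
have [[s [irs es]] _] := ufdR x0 xnu.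
have [[t [irt et]] _] := ufdR y0 ynu.
have fst : factorization (x * y) (s ++ t).
  split=> [r|]; last by rewrite big_cat -es -et.
  by rewrite mem_cat => /orP[/irs|/irt].
have dvd_prod r (u : seq R) : r \in u -> dvd r (\prod_(i <- u) i).
  by move=> ru; rewrite (big_rem r) //= mulrC; apply/dvd_mull/dvd_refl.
have [||r] := irreducible_dvd_factor irq _ _ fst qxy; rewrite ?mulf_neq0 //.
  by rewrite unitrM negb_and xnu.
rewrite mem_cat es et => /orP[rs|rt] qr.
  by left; apply: dvd_trans qr (dvd_prod _ _ rs).
by right; apply: dvd_trans qr (dvd_prod _ _ rt).
Qed.

Lemma ufd_ind (P : R -> Prop) :
    (forall u, u \is a GRing.unit -> P u) ->
    (forall q a, irreducible q -> P a -> P (q * a)) ->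
  forall a, a != 0 -> P a.
Proof.
move=> Pu Pq a a0; have [/Pu //|anu] := boolP (a \is a GRing.unit).
have [[s [irs ->]] _] := ufdR a0 anu.
elim: s irs => [_|q s IH irs]; first by rewrite big_nil; apply/Pu/unitr1.
rewrite big_cons; apply: Pq; first by apply: irs; rewrite mem_head.
by apply: IH => r rs; apply: irs; rewrite inE rs orbT.
Qed.

(** This is where primality of q enters: in q * (a * y) = z * b the factor q has
    to come from z, hence cancels. *)
Lemma coprime_irreducible_mul q a b :
  irreducible q -> ~ dvd q b -> coprime_elt a b -> coprime_elt (q * a) b.
Proof.
move=> irq nqb cab y; rewrite -mulrA => -[z e]; apply: cab.
have [[w ew]|//] : dvd q z \/ dvd q b.
  by apply: irreducible_prime => //; exists (a * y); rewrite -e mulrC.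
have [q0 _ _] := irq.
by exists w; apply: (mulfI q0); rewrite e ew; ring.
Qed.

(** Induction on the irreducible factors of a: a factor q that divides b joins
    g and is removed from b, any other joins a', where it cannot divide b'. *)
Lemma coprime_cofactors a b : a != 0 ->
  exists g a' b', [/\ a = g * a', b = g * b' & coprime_elt a' b'].
Proof.
move=> a0; elim/ufd_ind: a / a0 b => [u uu b|q a irq IH b].
  exists 1, u, b; rewrite !mul1r; split=> // y by'.
  by rewrite -(mulKr uu y); apply: dvd_mull.
have [[c ->]|nqb] := pselect (dvd q b).
  have [g [a' [b' [-> -> cab]]]] := IH c.
  by exists (q * g), a', b'; split=> //; ring.
have [g [a' [b' [ea eb cab]]]] := IH b.
exists g, (q * a'), b'; split=> //; first by rewrite ea; ring.
apply: coprime_irreducible_mul => // qb'; apply: nqb.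
by rewrite eb; apply: dvd_mull.
Qed.

(** One l serves all exponents because the decomposition into g, a' and b' is
    raised to the n-th power as it stands: when (g * b')^n divides
    (g * a')^n * t, coprimality of a'^n and b'^n makes b'^n divide t. *)
Lemma ufd_lcm_exp a b : exists l, forall n c,
  dvd (l ^+ n) c <-> dvd (a ^+ n) c /\ dvd (b ^+ n) c.
Proof.
have dvd_exp0 n (d : R) : dvd (d ^+ n) (0 ^+ n).
  by apply: dvd_exp; exists 0; rewrite mul0r.
have [->|a0] := eqVneq a 0.
  exists 0 => n c; split=> [h|[]//]; split=> //.
  exact: dvd_trans (dvd_exp0 n b) h.
have [->|b0] := eqVneq b 0.
  exists 0 => n c; split=> [h|[]//]; split=> //.
  exact: dvd_trans (dvd_exp0 n a) h.
have [g [a' [b' [ea eb cab]]]] := coprime_cofactors b a0.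
have b'0 : b' != 0 by apply: contraNneq b0 => e; rewrite eb e mulr0.
exists (g * a' * b') => n c; split=> [lc|].
  by split; apply: dvd_trans lc; apply: dvd_exp; rewrite ?ea ?eb;
    [exists b' | exists a']; ring.
move=> [[t et] bc].
have : dvd (b' ^+ n) t.
  apply: (coprime_expr b'0 (coprime_expl (n := n) cab)).
  apply: (@dvd_mul2l (g ^+ n)); last first.
    by rewrite -exprMn -eb mulrA -exprMn -ea mulrC -et.
  by apply: expf_neq0; apply: contraNneq a0 => e; rewrite ea e mul0r.
by case=> w ew; exists w; rewrite et ew ea !exprMn; ring.
Qed.

End UniqueFactorization.

Section PerfectionDivisibility.
Variables (R : idomainType) (p : nat) (chRp : p \in [pchar R]).
Implicit Types a b c : R.
Local Notation perf_in := (perf_in chRp).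

Lemma perf_in_exp k n a : perf_in (n + k) (a ^+ (p ^ k)) = perf_in n a.
Proof. by rewrite -(Perfection.iterFE chRp); apply: Perfection.inj_iterF. Qed.

Lemma perf_in_inj n : injective (perf_in n).
Proof.
move=> a b /perf_in_eq[k [_ _ /eqP]].
rewrite -subr_eq0 -Perfection.iterF_N -Perfection.iterF_D Perfection.iterFE.
by rewrite expf_eq0 subr_eq0 => /andP[_ /eqP].
Qed.

(** A cofactor in the perfection lives on some level m, and all three elements
    can be compared on the level n + m; moving from level n to level n + k
    raises representatives to the power p^k. *)
Lemma perf_dvdP n a c :
  dvd (perf_in n a) (perf_in n c) <->
  exists k, dvd (a ^+ (p ^ k)) (c ^+ (p ^ k)).
Proof.
split=> [[z]|[k [z e]]]; last first.
  exists (perf_in (n + k) z).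
  by rewrite -(perf_in_exp k n a) -(perf_in_exp k n c) e rmorphM.
have [m [z' ->]] := perf_in_surj z => e; exists m, (z' ^+ (p ^ n)).
apply: (@perf_in_inj (n + m)); rewrite rmorphM /= !perf_in_exp.
by rewrite [X in perf_in X (z' ^+ _)]addnC perf_in_exp.
Qed.

Lemma perf_mul_eq0 (x y : perfection chRp) : x * y = 0 -> x = 0 \/ y = 0.
Proof.
have [n [a [b [-> ->]]]] := Perfection.inj_common x y.
rewrite -!/(perf_in n _) -rmorphM -(rmorph0 (perf_in n)) => /perf_in_inj/eqP.
by rewrite mulf_eq0 => /orP[]/eqP ->; [left|right].
Qed.

End PerfectionDivisibility.

Theorem theorem2p1 (R : idomainType) (p : nat) (chRp : p \in [pchar R]%R) :
  noetherian R -> unique_factorization_domain R -> gcd_domain (perfection chRp).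
Proof.
move=> _ ufdR; split=> [|r s]; first exact: perf_mul_eq0.
have [n [a [b [-> ->]]]] := Perfection.inj_common r s.
have [l l_lcm] := ufd_lcm_exp ufdR a b.
exists (perf_in chRp n l); apply/esym/predeqP => x.
change (dvd (perf_in chRp n l) x <->
  dvd (perf_in chRp n a) x /\ dvd (perf_in chRp n b) x).
(* For x on level m, compare everything on the common level m + n. *)
have [m [c ->]] := perf_in_surj x.
rewrite -(perf_in_exp chRp n m c) addnC -!(perf_in_exp chRp m n) !perf_dvdP.
have l_lcmF k d : dvd ((l ^+ (p ^ m)) ^+ (p ^ k)) d <->
    dvd ((a ^+ (p ^ m)) ^+ (p ^ k)) d /\ dvd ((b ^+ (p ^ m)) ^+ (p ^ k)) d.
  by rewrite -!exprM l_lcm.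
split=> [[k /l_lcmF[ac bc]]|[[i ac] [j bc]]]; first by split; exists k.
exists (i + j)%N; apply/l_lcmF; split.
  by rewrite expnD !(exprM _ (p ^ i)); apply: dvd_exp.
by rewrite addnC expnD !(exprM _ (p ^ j)); apply: dvd_exp.
Qed.
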